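(* (1) Let $A, B \subset \mathbb{N}$ be infinite sets such that $s_A = +\infty$ and $d_{A,B} < +\infty$. Then $$\frac{1}{4d_{A,B}+1} \le \liminf_{x\to\infty} \frac{s_B(x)}{s_A(x - 2d_{A,B})} \le \limsup_{x\to\infty} \frac{s_B(x)}{s_A(x+2d_{A,B})} \le 4d_{A,B}+1.$$ (2) Let $d$ be a positive integer and let $\alpha, \beta$ be positive real numbers such that $\frac{1}{4d+1} \le \alpha \le \beta \le 4d+1$. Then there exist infinite sets $A, B \subset \mathbb{N}$ such that $s_A = +\infty$, $d_{A,B} = d$ and $$\liminf_{x\to\infty} \frac{s_B(x)}{s_A(x-2d)} = \alpha, \qquad \limsup_{x\to\infty} \frac{s_B(x)}{s_A(x+2d)} = \beta.$$
   Context: $\mathbb{N}$ denotes the set of nonnegative integers. For infinite sets $A = \{a_1 < a_2 < \cdots\}$, $B = \{b_1 < b_2 < \cdots\}$ of nonnegative integers, enumerated increasingly: $R_A(n)$ is the number of pairs $(i,j)$ with $i \le j$ and $a_i + a_j = n$; $s_A(x) = \max_{n \le x} R_A(n)$ and $s_A = \lim_{x\to\infty} s_A(x) \in \mathbb{N}\cup\{\infty\}$ (similarly for $B$); $d_{A,B}(x) = \max\{|a_t - b_t| : a_t \le x \text{ or } b_t \le x\}$ and $d_{A,B} = \lim_{x\to\infty} d_{A,B}(x) \in \mathbb{N}\cup\{\infty\}$. *)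

(* Defs.v *)
From HB Require Import structures.
From mathcomp Require Import all_boot all_order all_algebra.
From mathcomp Require Import all_classical all_reals all_analysis.

Set Implicit Arguments.
Unset Strict Implicit.
Unset Printing Implicit Defensive.

Import Order.TTheory GRing.Theory Num.Theory.
Import numFieldNormedType.Exports.

Local Open Scope classical_set_scope.
Local Open Scope ring_scope.

Definition least (A : set nat) : nat :=
  xget 0%N [set n | A n /\ forall m, A m -> (n <= m)%N].

(* Meaningful for infinite A only.  Indices start at 0: if A = {a_1 < a_2 < a_3 < _}
   then elt A k is a_(k+1); see elt_mem, elt_ltS and elt_onto. *)
Fixpoint elt (A : set nat) (k : nat) : nat :=
  if k is k'.+1 then least (A `&` [set n | (elt A k' < n)%N]) else least A.

Lemma leastP (A : set nat) :
  A !=set0 -> A (least A) /\ forall m, A m -> (least A <= m)%N.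
Proof.
move=> [a Aa]; rewrite /least; case: xgetP => [n -> //|/=].
have ex : exists n, `[< A n >] by exists a; apply/asboolP.
case: (ex_minnP ex) => m /asboolP Am mmin /(_ m) [].
by split=> // k Ak; apply: mmin; apply/asboolP.
Qed.

Lemma infinite_gt (A : set nat) (n : nat) :
  infinite_set A -> A `&` [set m | (n < m)%N] !=set0.
Proof.
move=> Ainf; apply/set0P/negP => /eqP A0; apply: Ainf.
apply: (@sub_finite_set _ _ `I_n.+1) (finite_II _) => m Am /=.
rewrite ltnS leqNgt; apply/negP => nm.
by have : (A `&` [set m | (n < m)%N]) m by []; rewrite A0.
Qed.

Lemma elt_mem (A : set nat) (k : nat) : infinite_set A -> A (elt A k).
Proof.
move=> Ainf; case: k => [|k] /=.
  by have [] := leastP (infinite_setN0 Ainf).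
by have [[]] := leastP (infinite_gt (elt A k) Ainf).
Qed.

Lemma elt_ltS (A : set nat) (k : nat) :
  infinite_set A -> (elt A k < elt A k.+1)%N.
Proof. by move=> /(infinite_gt (elt A k))/leastP[[]]. Qed.

Lemma leq_elt (A : set nat) (k : nat) : infinite_set A -> (k <= elt A k)%N.
Proof.
by move=> Ainf; elim: k => // k /leq_ltn_trans; apply; exact: elt_ltS.
Qed.

Lemma elt_onto (A : set nat) (n : nat) :
  infinite_set A -> A n -> exists k, elt A k = n.
Proof.
move=> Ainf An.
have ex : exists k, (n <= elt A k)%N by exists n; exact: leq_elt.
case: (ex_minnP ex) => -[|k] nk kmin; [exists 0%N|exists k.+1];
  apply/eqP; rewrite eqn_leq nk andbT.
  by have [_] := leastP (infinite_setN0 Ainf); apply.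
have [_] := leastP (infinite_gt (elt A k) Ainf); apply; split=> //=.
by rewrite ltnNge; apply/negP => /kmin; rewrite ltnn.
Qed.

(* For an infinite set, i <= elt A i (lemma leq_elt), so the indices of any
   representation of n are at most n and no pair is lost by the bound. *)
Definition rep (A : set nat) (n : nat) : nat :=
  #|[pred p : 'I_n.+1 * 'I_n.+1 |
      (p.1 <= p.2)%N && (elt A p.1 + elt A p.2 == n)%N]|.

(* x is real; every natural number n <= x satisfies n < (Num.truncn x).+1.  For
   x < 0 there is no such n and the maximum is 0. *)
Definition s_upto (R : realType) (A : set nat) (x : R) : nat :=
  \max_(n < (Num.truncn x).+1 | (n%:R : R) <= x) rep A n.

Definition s_lim (R : realType) (A : set nat) : \bar R :=
  lim ((s_upto A (x : R))%:R%:E @[x --> +oo%R] : set_system (\bar R)).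

(* Again by leq_elt, either condition on t forces t <= x. *)
Definition d_upto (R : realType) (A B : set nat) (x : R) : nat :=
  \max_(t < (Num.truncn x).+1 |
        ((elt A t)%:R <= x) || ((elt B t)%:R <= x))
    `|(elt A t)%:Z - (elt B t)%:Z|%N.

Definition d_lim (R : realType) (A B : set nat) : \bar R :=
  lim ((d_upto A B (x : R))%:R%:E @[x --> +oo%R] : set_system (\bar R)).

(* The quotient s_B(x) / s_A(x + c).  When the denominator vanishes its value is
   0 by convention; if s_A is infinite the denominator is positive for all
   large x, so this does not affect limits at +oo. *)
Definition s_ratio (R : realType) (A B : set nat) (c x : R) : \bar R :=
  ((s_upto B x)%:R / (s_upto A (x + c))%:R)%:E.

Lemma le_s_upto (R : realType) (A : set nat) (x y : R) :
  x <= y -> (s_upto A x <= s_upto A y)%N.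
Proof.
move=> xy; apply/bigmax_leqP => n nx.
have ny : (n%:R : R) <= y := le_trans nx xy.
have nty : (n < (Num.truncn y).+1)%N.
  by rewrite ltnS truncn_ge_nat // (le_trans _ ny).
exact: (@leq_bigmax_cond _ (fun i : 'I__ => (i%:R : R) <= y)
          (fun i => rep A i) (Ordinal nty)).
Qed.

Lemma le_d_upto (R : realType) (A B : set nat) (x y : R) :
  x <= y -> (d_upto A B x <= d_upto A B y)%N.
Proof.
move=> xy; apply/bigmax_leqP => t tx.
have ty : ((elt A t)%:R <= y) || ((elt B t)%:R <= y).
  by case/orP: tx => /le_trans/(_ xy) ->; rewrite ?orbT.
have tty : (t < (Num.truncn y).+1)%N.
  by apply: leq_trans (ltn_ord t) _; rewrite ltnS le_truncn.
exact: (@leq_bigmax_cond _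
  (fun i : 'I__ => ((elt A i)%:R <= y) || ((elt B i)%:R <= y))
  (fun i => `|(elt A i)%:Z - (elt B i)%:Z|%N) (Ordinal tty)).
Qed.

Lemma s_limE (R : realType) (A : set nat) :
  s_lim R A = ereal_sup (range (fun x : R => (s_upto A x)%:R%:E)).
Proof.
apply/cvg_lim => //; apply: nondecreasing_cvge => x y xy.
by rewrite lee_fin ler_nat le_s_upto.
Qed.

Lemma d_limE (R : realType) (A B : set nat) :
  d_lim R A B = ereal_sup (range (fun x : R => (d_upto A B x)%:R%:E)).
Proof.
apply/cvg_lim => //; apply: nondecreasing_cvge => x y xy.
by rewrite lee_fin ler_nat le_d_upto.
Qed.

(* Main.v *)
Require Import Defs.
From HB Require Import structures.
From mathcomp Require Import all_boot all_order all_algebra.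
From mathcomp Require Import all_classical all_reals all_analysis.
From mathcomp Require Import zify lra.

Set Implicit Arguments.
Unset Strict Implicit.
Unset Printing Implicit Defensive.

Import Order.TTheory GRing.Theory Num.Theory.
Import numFieldNormedType.Exports.

Local Open Scope classical_set_scope.
Local Open Scope ring_scope.

(** First assertion.  Moving every element by at most [D] moves every sum of two
    elements by at most [2 * D], so each representation of [n] by [B] is, with
    the same indices, a representation by [A] of one of the [4 * D + 1] integers
    at distance at most [2 * D] from [n] ([rep_le_sum_shifts]).  Hence
    [s_B(x) <= (4 D + 1) s_A(x + 2 D)], and the same with [A] and [B] exchanged;
    this gives the two outer bounds.  The inequality between the lower and the
    upper limit is not pointwise; it comes from the linear growth of [s_A]
    ([linear_bound_slow_growth], used in [s_ratio_bounds]).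

    Second assertion.  With [m = 4 d + 1], take integers [p k = m ^ (2 k + 2)]
    and let [q k] be the integer part of [alpha * p k] for even [k] and of
    [beta * p k] for odd [k] ([exists_oscillating_steps]).  It suffices to find
    [A] and [B] whose functions [s_A] and [s_B] are, up to bounded translations
    of the jumps, the step functions with values [p k] and [q k].  The shifts by
    [2 d] in the two quotients are exactly what makes a misalignment of the
    jumps by at most [2 d] harmless ([s_ratio_limits]).

    The sets are made of blocks.  Block [k] consists of [n k = max (p k) (q k)]
    pairs; both members of a pair are far apart, and the sum of every pair is
    close to a common huge integer, the center of the block.  A small
    perturbation of the members, between [0] and [2 d], spreads the sums of the
    pairs over at most [4 d + 1] consecutive integers or keeps them all equal.
    Whichever of [A] and [B] must have the larger count keeps them equal; the
    other one spreads them in groups of [p k] (respectively [q k]).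

    Elsewhere there must be no multiple representation.  This holds because the
    elements are written with few signed digits in a large base: an equality of
    two sums of two elements is an equality of digit sequences
    ([digits_add_eq]), which forces the two pairs to be equal or to be pairs of
    the same block ([elem_sum_eq]). *)

(** * Lower and upper limits at infinity *)

Lemma limf_esup_pinfty_le (R : realType) (f : R -> \bar R) (M : R) (c : \bar R) :
  (forall x, M <= x -> (f x <= c)%E) -> (limf_esup f +oo%R <= c)%E.
Proof.
move=> fc; rewrite limf_esupE; apply: ge_ereal_inf.
exists (ereal_sup (f @` [set x | M <= x])).
  by exists [set x | M <= x] => //; apply: nbhs_pinfty_ge; rewrite num_real.
by apply: ge_ereal_sup => _ [x Mx <-]; exact: fc.
Qed.

Lemma limf_esup_pinfty_ge (R : realType) (f : R -> \bar R) (c : \bar R) :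
  (forall M, exists2 x, M <= x & (c <= f x)%E) -> (c <= limf_esup f +oo%R)%E.
Proof.
move=> fc; rewrite limf_esupE; apply: le_ereal_inf_tmp => _ [A [M [_ MA]] <-].
have [x Mx cfx] := fc (M + 1).
apply: le_trans cfx _; apply: ereal_sup_ubound; exists x => //; apply: MA.
by rewrite (lt_le_trans _ Mx)// ltrDl.
Qed.

Lemma limf_einf_pinfty_ge (R : realType) (f : R -> \bar R) (M : R) (c : \bar R) :
  (forall x, M <= x -> (c <= f x)%E) -> (c <= limf_einf f +oo%R)%E.
Proof.
move=> fc; rewrite leeNr; apply: (@limf_esup_pinfty_le _ _ M) => x Mx /=.
by rewrite leeN2 fc.
Qed.

Lemma limf_einf_pinfty_le (R : realType) (f : R -> \bar R) (c : \bar R) :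
  (forall M, exists2 x, M <= x & (f x <= c)%E) -> (limf_einf f +oo%R <= c)%E.
Proof.
move=> fc; rewrite leeNl; apply: limf_esup_pinfty_ge => M.
by have [x Mx fx] := fc M; exists x => //=; rewrite leeN2.
Qed.

Lemma limf_esup_pinfty_lt (R : realType) (f : R -> \bar R) (c : \bar R) :
  (limf_esup f +oo%R < c)%E -> exists M, forall x, M <= x -> (f x < c)%E.
Proof.
move=> fc; apply: contrapT => nM; move: fc; apply/negP; rewrite -leNgt.
apply: limf_esup_pinfty_ge => M; apply: contrapT => nx; apply: nM.
by exists M => x Mx; rewrite ltNge; apply/negP => cfx; apply: nx; exists x.
Qed.

Lemma limf_einf_pinfty_gt (R : realType) (f : R -> \bar R) (c : \bar R) :
  (c < limf_einf f +oo%R)%E -> exists M, forall x, M <= x -> (c < f x)%E.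
Proof.
rewrite lteNr => /limf_esup_pinfty_lt[M fM].
by exists M => x /fM; rewrite lteN2.
Qed.

(** * Representation counts of two close sets *)

Lemma rep_le_s_upto (R : realType) (A : set nat) (n : nat) (x : R) :
  n%:R <= x -> (rep A n <= s_upto A x)%N.
Proof.
move=> nx; have nlt : (n < (Num.truncn x).+1)%N.
  by rewrite ltnS truncn_ge_nat // (le_trans _ nx).
exact: (@leq_bigmax_cond _ (fun i : 'I__ => (i%:R : R) <= x)
          (fun i => rep A i) (Ordinal nlt)).
Qed.

Lemma s_upto_le (R : realType) (A : set nat) (x : R) (m : nat) :
  (forall n, n%:R <= x -> (rep A n <= m)%N) -> (s_upto A x <= m)%N.
Proof. by move=> Am; apply/bigmax_leqP => n; exact: Am. Qed.

(** The index bound in [rep] can be raised at will, which lets representations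
    of different integers be compared inside one finite type. *)
Lemma rep_widen (A : set nat) (n N : nat) : infinite_set A -> (n <= N)%N ->
  rep A n = #|[pred p : 'I_N.+1 * 'I_N.+1 |
      (p.1 <= p.2)%N && (elt A p.1 + elt A p.2 == n)%N]|.
Proof.
move=> Ainf nN.
pose h (p : 'I_n.+1 * 'I_n.+1) : 'I_N.+1 * 'I_N.+1 :=
  (widen_ord (n:=n.+1) (m:=N.+1) nN p.1, widen_ord (n:=n.+1) (m:=N.+1) nN p.2).
have hinj : injective h.
  by move=> [a b] [a' b'] [aa bb]; congr pair; apply/val_inj.
rewrite /rep -(fintype.card_image hinj); apply: eq_card => -[i j].
apply/fintype.imageP/idP => [[[a b] + ->]|]; first by rewrite !inE.
rewrite inE /= => /andP[ij /eqP ijn].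
have := leq_elt i Ainf; have := leq_elt j Ainf => jj ii.
have iltn : (i < n.+1)%N by lia.
have jltn : (j < n.+1)%N by lia.
exists (Ordinal iltn, Ordinal jltn); first by rewrite inE /= ij ijn eqxx.
by congr pair; apply/val_inj.
Qed.

(** The first index of a representation determines the second one. *)
Lemma rep_leqS (A : set nat) (n : nat) : infinite_set A -> (rep A n <= n.+1)%N.
Proof.
move=> Ainf; rewrite /rep -[leqRHS]card_ord.
rewrite -(@card_in_imset _ _ fst); first exact: max_card.
move=> [i j] [i' j']; rewrite !inE /= => /andP[_ /eqP e] /andP[_ /eqP e'] ii.
congr pair => //; apply/val_inj/eqP => /=; rewrite -ii in e'.
have /eqP : elt A j = elt A j' by apply/eqP; rewrite -(eqn_add2l (elt A i)) e e'.
have mono : {mono elt A : x y / (x <= y)%N}.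
  by apply: leq_mono; apply: homo_ltn => [|k]; [exact: ltn_trans|exact: elt_ltS].
by rewrite (inj_eq (incn_inj mono)).
Qed.

(** If corresponding elements of [A] and [B] differ by at most [D], then a
    representation of [n] by [B] becomes, with the same indices, a
    representation by [A] of one of the [4 * D + 1] integers in
    [n - 2 * D, n + 2 * D]. *)
Lemma rep_le_sum_shifts (A B : set nat) (D n : nat) :
  infinite_set A -> infinite_set B ->
  (forall t, (`|(elt A t)%:Z - (elt B t)%:Z| <= D)%N) ->
  (rep B n <= \sum_(v < (4 * D).+1 | 2 * D <= n + v) rep A (n + v - 2 * D))%N.
Proof.
move=> Ainf Binf AB.
have nN : (n <= n + 2 * D)%N by lia.
rewrite (rep_widen Binf nN).
under eq_bigr => v _.
  have vN : (n + v - 2 * D <= n + 2 * D)%N by have := ltn_ord v; lia.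
  rewrite (rep_widen Ainf vN); over.
rewrite -sum1_card.
under [leqRHS]eq_bigr do rewrite -sum1_card big_mkcond.
rewrite exchange_big /= big_mkcond; apply: leq_sum => -[i j] _.
rewrite !inE /=; case: ifP => // /andP[ij /eqP e].
have := AB i; have := AB j => Di Dj.
(* The index [v] records the difference between the two sums, offset by [2 * D]. *)
have vlt : (elt A i + elt A j + 2 * D - n < (4 * D).+1)%N by lia.
rewrite (bigD1 (Ordinal vlt)) /=; last by lia.
by rewrite inE /= ij ifT //; lia.
Qed.

Lemma s_upto_le_shift (R : realType) (A B : set nat) (D : nat) (x : R) :
  infinite_set A -> infinite_set B ->
  (forall t, (`|(elt A t)%:Z - (elt B t)%:Z| <= D)%N) ->
  (s_upto B x <= (4 * D + 1) * s_upto A (x + (2 * D)%:R))%N.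
Proof.
move=> Ainf Binf AB; apply: s_upto_le => n nx.
apply: leq_trans (rep_le_sum_shifts n Ainf Binf AB) _.
rewrite addn1 [leqRHS]mulnC -[leqRHS]addn0 -iter_addn -big_const_ord.
rewrite big_mkcond; apply: leq_sum => v _; case: ifP => // nv.
apply: rep_le_s_upto.
have vlt := ltn_ord v.
apply: (@le_trans _ _ (n + 2 * D)%:R); first by rewrite ler_nat; lia.
by rewrite natrD lerD2r.
Qed.

Lemma s_upto_linear (R : realType) (A : set nat) (x : R) :
  infinite_set A -> 0 <= x -> (s_upto A x)%:R <= x + 1.
Proof.
move=> Ainf x0; apply: (@le_trans _ _ ((Num.truncn x).+1)%:R).
  rewrite ler_nat; apply: s_upto_le => n nx.
  by apply: leq_trans (rep_leqS n Ainf) _; rewrite ltnS truncn_ge_nat.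
by rewrite -natr1 lerD2r; have /andP[] := truncn_itv x0.
Qed.

Lemma s_lim_pinftyP (R : realType) (A : set nat) (m : nat) :
  s_lim R A = +oo%E -> exists M : R, forall x, M <= x -> (m <= s_upto A x)%N.
Proof.
rewrite s_limE => Aoo; apply: contrapT => nM.
suff : (+oo <= m%:R%:E :> \bar R)%E by [].
rewrite -Aoo; apply: ge_ereal_sup => _ [M _ <-].
rewrite lee_fin ler_nat leqNgt; apply/negP => mM; apply: nM; exists M => x Mx.
by apply: leq_trans (ltnW mM) (le_s_upto A Mx).
Qed.

Lemma dist_le_d_upto (R : realType) (A B : set nat) (t : nat) :
  infinite_set A ->
  (`|(elt A t)%:Z - (elt B t)%:Z| <= d_upto A B ((elt A t)%:R : R))%N.
Proof.
move=> Ainf.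
have tlt : (t < (Num.truncn ((elt A t)%:R : R)).+1)%N.
  by rewrite ltnS truncn_ge_nat // ler_nat leq_elt.
apply: (@leq_bigmax_cond _
  (fun i : 'I__ => ((elt A i)%:R <= (elt A t)%:R :> R) ||
                   ((elt B i)%:R <= (elt A t)%:R :> R))
  (fun i => `|(elt A i)%:Z - (elt B i)%:Z|%N) (Ordinal tlt)).
by rewrite lexx.
Qed.

(** A finite limit of the natural numbers [d_upto A B x] is itself a natural
    number. *)
Lemma d_lim_natP (R : realType) (A B : set nat) :
  infinite_set A -> (d_lim R A B < +oo)%E ->
  exists2 D : nat, d_lim R A B = D%:R%:E &
    forall t, (`|(elt A t)%:Z - (elt B t)%:Z| <= D)%N.
Proof.
move=> Ainf dfin.
have dle (x : R) : ((d_upto A B x)%:R%:E <= d_lim R A B)%E.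
  by rewrite d_limE; apply: ereal_sup_ubound; exists x.
have d0 : (0 <= d_lim R A B)%E by apply: le_trans (dle 0); rewrite lee_fin.
have [r rE] : exists r, d_lim R A B = r%:E.
  by exists (fine (d_lim R A B)); rewrite fineK // ge0_fin_numE.
move: d0; rewrite rE lee_fin => r0.
have dleD (x : R) : (d_upto A B x <= Num.truncn r)%N.
  by rewrite truncn_ge_nat // -lee_fin -rE.
exists (Num.truncn r) => [|t]; last first.
  exact: leq_trans (dist_le_d_upto R B t Ainf) (dleD _).
apply/eqP; rewrite eq_le !lee_fin; have /andP[-> _] := truncn_itv r0.
rewrite andbT -lee_fin -rE d_limE; apply: ge_ereal_sup => _ [x _ <-].
by rewrite lee_fin ler_nat.
Qed.

(** * Bounds on the lower and upper limits *)

(** Otherwise [f (M + n * c)] would dominate [rho ^ n]. *)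
Lemma linear_bound_slow_growth (R : realType) (f : R -> R) (rho c M : R) :
  1 < rho -> 0 <= c -> 0 <= M -> (forall x, 0 <= x -> f x <= x + 1) ->
  1 <= f M -> exists2 x, M <= x & f (x + c) < rho * f x.
Proof.
move=> rho1 c0 M0 flin fM; apply: contrapT => nx.
have fgrow x : M <= x -> rho * f x <= f (x + c).
  by move=> Mx; rewrite leNgt; apply/negP => fx; apply: nx; exists x.
have Mn n : M <= M + n%:R * c by rewrite lerDl mulr_ge0.
have fexp n : rho ^+ n <= f (M + n%:R * c).
  elim: n => [|n IH]; first by rewrite mul0r addr0.
  rewrite -natr1 mulrDl mul1r addrA exprS.
  by apply: le_trans (fgrow _ (Mn n)); rewrite ler_pM2l //; lra.
have bern n : 1 + n%:R * (rho - 1) <= rho ^+ n.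
  elim: n => [|n IH]; first by rewrite mul0r addr0.
  rewrite -natr1 exprS.
  have : rho * (1 + n%:R * (rho - 1)) <= rho * rho ^+ n by rewrite ler_pM2l //; lra.
  have : 0 <= n%:R * (rho - 1) ^+ 2 by rewrite mulr_ge0 ?sqr_ge0.
  by rewrite expr2; lra.
(* Bernoulli's inequality gives only linear growth of [rho ^+ n]; squaring it
   gives quadratic growth of [rho ^+ (n + n)], which beats the linear bound. *)
set e := rho - 1 in bern; have e0 : 0 < e by rewrite subr_gt0.
pose n := (Num.truncn ((M + 2 * c + 1) / e ^+ 2)).+1.
have nbig : (M + 2 * c + 1) < n%:R * e ^+ 2.
  by rewrite -ltr_pdivrMr ?exprn_gt0 //; exact: truncnS_gt.
have n1 : 1 <= n%:R :> R by rewrite ler1n.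
have sq : (1 + n%:R * e) ^+ 2 <= M + (n + n)%:R * c + 1.
  apply: (@le_trans _ _ (rho ^+ (n + n))).
    rewrite exprD expr2; apply: ler_pM (bern n) (bern n); nra.
  by apply: le_trans (fexp _) (flin _ _); exact: le_trans (Mn _).
by move: sq; rewrite natrD; nra.
Qed.

(** Both outer bounds are the inequality [s_B(x) <= (4 D + 1) s_A(x + 2 D)],
    read in the two directions.  The middle one is not pointwise, since
    [s_A(x - 2 D) <= s_A(x + 2 D)]; it holds because a function of at most
    linear growth cannot satisfy [rho * s_A(x - 2 D) <= s_A(x + 2 D)] for all
    large [x] with a fixed [rho > 1]. *)
Lemma s_ratio_bounds (R : realType) (A B : set nat) (D : nat) :
  infinite_set A -> infinite_set B -> s_lim R A = +oo%E ->
  (forall t, (`|(elt A t)%:Z - (elt B t)%:Z| <= D)%N) ->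
  [/\ (((4 * D%:R + 1 : R)^-1)%:E <=
         limf_einf (s_ratio A B (- (2 * D%:R))) +oo%R)%E,
      (limf_einf (s_ratio A B (- (2 * D%:R : R))) +oo%R
         <= limf_esup (s_ratio A B (2 * D%:R : R)) +oo%R)%E
    & (limf_esup (s_ratio A B (2 * D%:R)) +oo%R <= (4 * D%:R + 1 : R)%:E)%E].
Proof.
move=> Ainf Binf Aoo AB.
have [M0 M0P] := s_lim_pinftyP 1 Aoo.
have mE : (4 * D%:R + 1 : R) = (4 * D + 1)%:R by rewrite natrD natrM.
have dE : (2 * D%:R : R) = (2 * D)%:R by rewrite natrM.
have m0 : 0 < (4 * D + 1)%:R :> R by rewrite ltr0n; lia.
have BA t : (`|(elt B t)%:Z - (elt A t)%:Z| <= D)%N by have := AB t; lia.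
rewrite mE dE; set c : R := (2 * D)%:R; have c0 : 0 <= c by exact: ler0n.
have sB x : (s_upto B x)%:R <= (4 * D + 1)%:R * (s_upto A (x + c))%:R :> R.
  by rewrite -natrM ler_nat; exact: s_upto_le_shift.
have sA x : (s_upto A (x - c))%:R <= (4 * D + 1)%:R * (s_upto B x)%:R :> R.
  rewrite -natrM ler_nat; have := s_upto_le_shift (x - c) Binf Ainf BA.
  by rewrite -/c subrK.
have pos x : M0 <= x -> 0 < (s_upto A x)%:R :> R.
  by move=> /M0P; rewrite ltr0n.
split.
- apply: (@limf_einf_pinfty_ge _ _ (M0 + c)) => x Mx; rewrite /s_ratio lee_fin.
  have p : 0 < (s_upto A (x - c))%:R :> R by apply: pos; lra.
  by rewrite ler_pdivlMr // mulrC ler_pdivrMr // mulrC.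
- rewrite leNgt; apply/negP => UL.
  have U0 : (0 <= limf_esup (s_ratio A B c) +oo%R)%E.
    by apply: limf_esup_pinfty_ge => M; exists M => //; rewrite lee_fin divr_ge0.
  have [u [l [u0 ul Uu lL]]] : exists u l : R, [/\ 0 < u, u < l,
      (limf_esup (s_ratio A B c) +oo%R < u%:E)%E &
      (l%:E < limf_einf (s_ratio A B (- c)) +oo%R)%E].
    move: (limf_esup _ _) (limf_einf _ _) U0 UL => [v||] [w||] //=.
      rewrite lee_fin !lte_fin => v0 vw.
      exists ((2 * v + w) / 3), ((v + 2 * w) / 3).
      by split; rewrite ?lte_fin; lra.
    rewrite lee_fin => v0 _; exists (v + 1), (v + 2).
    by split; rewrite ?ltry ?lte_fin //; lra.
  have [M1 M1P] := limf_esup_pinfty_lt Uu.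
  have [M2 M2P] := limf_einf_pinfty_gt lL.
  pose M : R := Num.max 0 (Num.max M0 (Num.max M1 M2)).
  have [M_ge0 MM0 MM1 MM2] : [/\ 0 <= M, M0 <= M, M1 <= M & M2 <= M].
    by split; rewrite !le_max lexx ?orbT.
  (* For [x] large, [l * s_A(x - c) < s_B(x) < u * s_A(x + c)]. *)
  have [|||x Mx] := @linear_bound_slow_growth _ (fun x => (s_upto A x)%:R)
    (l / u) (c + c) M _ _ M_ge0 (fun x => s_upto_linear Ainf (x := x)).
  + by rewrite ltr_pdivlMr // mul1r.
  + exact: addr_ge0.
  + by rewrite ler1n; exact: M0P.
  apply/negP; rewrite -leNgt mulrAC ler_pdivrMr // mulrC.
  have px : 0 < (s_upto A x)%:R :> R by apply: pos; lra.
  have px' : 0 < (s_upto A (x + (c + c)))%:R :> R by apply: pos; lra.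
  have /M1P : M1 <= x + c by lra.
  have /M2P : M2 <= x + c by lra.
  rewrite /s_ratio !lte_fin addrK -addrA ltr_pdivlMr // ltr_pdivrMr //.
  lra.
- apply: (@limf_esup_pinfty_le _ _ (M0 - c)) => x Mx; rewrite /s_ratio lee_fin.
  by rewrite ler_pdivrMr //; apply: pos; lra.
Qed.

(** * Blocks of mirror pairs *)

Lemma elt_range (f : nat -> nat) (t : nat) :
  (forall i, f i < f i.+1)%N -> elt (range f) t = f t.
Proof.
move=> fS; have fmono : {mono f : x y / (x <= y)%N}.
  by apply: leq_mono; apply: homo_ltn => //; exact: ltn_trans.
elim: t => [|t IH] /=.
  have [|[i _ <-] /(_ (f 0%N))] := @leastP (range f); first by exists (f 0%N), 0%N.
  move=> f0; apply/eqP; rewrite eqn_leq; apply/andP; split; last by rewrite fmono.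
  by apply: f0; exists 0%N.
rewrite IH; set X := _ `&` _.
have [|[[i _ <-]] /= ti /(_ (f t.+1))] := @leastP X.
  by exists (f t.+1); split => //=; exists t.+1.
move=> fl; apply/eqP; rewrite eqn_leq; apply/andP; split.
  by apply: fl; split => //=; exists t.+1.
by rewrite fmono -(leqW_mono fmono).
Qed.

Lemma infinite_range_nat (f : nat -> nat) : injective f -> infinite_set (range f).
Proof.
move=> fi; apply/infiniteP; have := @inj_card_eq _ _ setT f (in2W fi).
by rewrite card_eq_le => /andP[].
Qed.

(** [u] evaluates at [l] the sum of two signed unit masses placed at two points.
    Cancellation is possible only between opposite signs at the same point, so
    two such sums that agree have the same masses or both vanish. *)
Lemma signed_pair_matching (a b a' b' : nat) (la lb la' lb' : bool) :
  let u (s t e f : bool) : int := (-1) ^+ (~~ s) * e%:Z + (-1) ^+ (~~ t) * f%:Z in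
  (forall l, l \in [:: a; b; a'; b'] ->
    u la lb (a == l) (b == l) = u la' lb' (a' == l) (b' == l)) ->
  [|| [&& a == a', la == la', b == b' & lb == lb'],
      [&& a == b', la == lb', b == a' & lb == la'] |
      [&& a == b, la != lb, a' == b' & la' != lb']].
Proof.
move=> u e; have := e a; have := e b; have := e a'; have := e b'.
rewrite !inE !eqxx !orbT /= => /(_ isT)/eqP + /(_ isT)/eqP + /(_ isT)/eqP + /(_ isT)/eqP.
clear e; rewrite (eq_sym b a) (eq_sym a' a) (eq_sym b' a) (eq_sym a' b) (eq_sym b' b) (eq_sym b' a').
rewrite /u; move: (a == b) (a == a') (a == b') (b == a') (b == b') (a' == b').
move: la lb la' lb'; clear.
(* The six equalities can be treated as independent booleans: transitivity of
   equality is not involved. *)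
do 10!case; done.
Qed.

Section MirrorBlocks.

(** Indices are cut into consecutive blocks; block [k] has [2 * n k] indices,
    and [mirror] reverses each block. *)

Variable n : nat -> nat.
Hypothesis n_gt0 : forall k, (0 < n k)%N.

Definition block_start k := (\sum_(l < k) 2 * n l)%N.

Lemma block_startS k : block_start k.+1 = (block_start k + 2 * n k)%N.
Proof. by rewrite /block_start big_ord_recr. Qed.

Lemma block_start_lt k : (block_start k < block_start k.+1)%N.
Proof. by rewrite block_startS; have := n_gt0 k; lia. Qed.

Lemma leq_block_start k l : (k <= l)%N -> (block_start k <= block_start l)%N.
Proof.
exact: (homo_leq (r := leq) leqnn leq_trans (fun i => ltnW (block_start_lt i))).
Qed.

Fixpoint block t : nat :=
  if t is t'.+1 then
    let k := block t' in if t == block_start k.+1 then k.+1 else k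
  else 0%N.

Lemma block_bounds t : (block_start (block t) <= t < block_start (block t).+1)%N.
Proof.
elim: t => [|t IH] /=.
  by rewrite {1}/block_start big_ord0 /= (leq_ltn_trans _ (block_start_lt 0)).
case: eqP => [->|tk]; first by rewrite leqnn block_start_lt.
by move: IH tk; lia.
Qed.

Lemma block_uniq t k : (block_start k <= t < block_start k.+1)%N -> block t = k.
Proof.
move=> tk; have := block_bounds t.
case: (ltngtP (block t) k) => // /leq_block_start; lia.
Qed.

Definition mirror t := (block_start (block t) + block_start (block t).+1 - t.+1)%N.

Definition low t := (t < mirror t)%N.

Definition half t := if low t then t else mirror t.

Definition depth t := (half t - block_start (block t))%N.

Lemma block_mirror t : block (mirror t) = block t.
Proof. by apply: block_uniq; have := block_bounds t; rewrite /mirror; lia. Qed.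

Lemma mirrorK : involutive mirror.
Proof.
by move=> t; rewrite {1}/mirror block_mirror /mirror; have := block_bounds t; lia.
Qed.

Lemma low_mirror t : low (mirror t) = ~~ low t.
Proof.
rewrite /low mirrorK; have := block_bounds t.
by rewrite /mirror block_startS; lia.
Qed.

Lemma half_mirror t : half (mirror t) = half t.
Proof. by rewrite /half low_mirror mirrorK; case: (low t). Qed.

Lemma block_half t : block (half t) = block t.
Proof. by rewrite /half; case: ifP => // _; exact: block_mirror. Qed.

Lemma low_half t : low (half t).
Proof.
by rewrite /half; case: ifPn => // tN; rewrite low_mirror.
Qed.

Lemma half_low_inj t t' : half t = half t' -> low t = low t' -> t = t'.
Proof.
move=> + l; rewrite /half -l; case: ifP => // _ e.
by rewrite -(mirrorK t) e mirrorK.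
Qed.

Lemma half_mirrorP t t' : half t = half t' -> low t <> low t' -> t' = mirror t.
Proof.
move=> h l; apply: half_low_inj; first by rewrite half_mirror.
by rewrite low_mirror; move: l; case: (low t); case: (low t').
Qed.

Lemma lowP t : low t = (t < block_start (block t) + n (block t))%N.
Proof. by rewrite /low /mirror block_startS; have := block_bounds t; lia. Qed.

Lemma depth_lt t : (depth t < n (block t))%N.
Proof.
have := low_half t; rewrite lowP /depth block_half.
have := block_bounds (half t); rewrite block_half; lia.
Qed.

Lemma half_depth t : half t = (block_start (block t) + depth t)%N.
Proof.
by rewrite /depth; have := block_bounds (half t); rewrite block_half; lia.
Qed.

Lemma block_low k i : (i < n k)%N -> block (block_start k + i) = k.
Proof. by move=> ik; apply: block_uniq; rewrite block_startS; lia. Qed.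

Lemma low_low k i : (i < n k)%N -> low (block_start k + i).
Proof. by move=> ik; rewrite lowP block_low //; lia. Qed.

Lemma depth_low k i : (i < n k)%N -> depth (block_start k + i) = i.
Proof. by move=> ik; rewrite /depth /half low_low // block_low // addKn. Qed.

Lemma block_start_neq_low t k : low t -> block_start k != t.+1.
Proof.
rewrite lowP => tl; have := block_bounds t; rewrite block_startS.
have [/leq_block_start|/leq_block_start] := leqP k (block t); first by lia.
by rewrite block_startS; lia.
Qed.

(** [shift k i] is the displacement, from the center of block [k], of the sum of
    its [i]-th mirror pair; each member of the pair receives half of it. *)

Variables (d : nat) (shift : nat -> nat -> nat).
Hypothesis d_gt0 : (0 < d)%N.
Hypothesis shift_half : forall k i, (i < n k)%N ->
  ((shift k i)./2 <= 2 * d)%N /\ (shift k i - (shift k i)./2 <= 2 * d)%N.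

(** Digits of elements are at most [2 * d] in absolute value, so those of the
    difference of two sums of two elements are at most [8 * d]. *)
Definition base := (8 * d).+1.

Definition offset t :=
  let c := shift (block t) (depth t) in
  if low t then c./2 else (c - c./2)%N.

(** The lower half of a block consists of powers of [base] with distinct
    exponents, and the upper half of their complements to the center of the
    block, itself a power of [base] whose exponent occurs in no lower half. *)
Definition elem t : nat :=
  ((if low t then base ^ t.+1
    else base ^ block_start (block t).+1 - base ^ (mirror t).+1) + offset t)%N.

Definition center k := (base ^ block_start k.+1)%N.

(** The signed expansion of [elem t] in base [base], as a polynomial; the digit
    of the units is the offset. *)
Definition digits t : {poly int} :=
  (if low t then 'X^(t.+1)
   else 'X^(block_start (block t).+1) - 'X^((mirror t).+1)) + ((offset t)%:Z)%:P.

Lemma offset_le t : (offset t <= 2 * d)%N.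
Proof.
by have [] := shift_half (depth_lt t); rewrite /offset; case: (low t).
Qed.

Lemma mirror_exp_lt t : ~~ low t -> ((mirror t).+1 < block_start (block t).+1)%N.
Proof.
rewrite -low_mirror lowP block_mirror block_startS.
by have := n_gt0 (block t); lia.
Qed.

Lemma elem_horner t : (elem t)%:Z = (digits t).[base%:Z].
Proof.
rewrite /elem /digits; case: ifPn => tl; rewrite !hornerE PoszD -?rmorphXn //=.
rewrite -subzn ?rmorphXn //= leq_pexp2l //; exact: ltnW (mirror_exp_lt tl).
Qed.

(** Exponents [l.+1] with [l] low reveal which pair an element belongs to and,
    by the sign, which member of it the element is. *)
Lemma digits_coef_low t l : low l ->
  (digits t)`_l.+1 = (-1) ^+ (~~ low t) * (half t == l)%:Z.
Proof.
move=> ll; rewrite /digits /half coefD coefC addr0.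
rewrite -natz; case: ifPn => tl; first by rewrite coefXn mul1r eqSS eq_sym.
rewrite coefB !coefXn eq_sym (negbTE (block_start_neq_low _ ll)) sub0r mulN1r.
by rewrite eqSS eq_sym.
Qed.

(** Exponents of centers reveal the block of an element of an upper half, hence
    still distinguish mirror pairs, whose other digits cancel. *)
Lemma digits_coef_start t k :
  (digits t)`_(block_start k.+1) = (~~ low t && (block t == k))%:R.
Proof.
have k0 : (block_start k.+1 == 0) = false.
  by apply/negbTE; have := block_start_lt k; lia.
rewrite /digits coefD coefC k0 addr0; case: ifPn => tl /=.
  by rewrite coefXn (negbTE (block_start_neq_low _ tl)).
have ml : low (mirror t) by rewrite low_mirror.
rewrite coefB !coefXn (negbTE (block_start_neq_low _ ml)) subr0.
have [->|] := eqVneq (block t) k; first by rewrite eqxx.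
have := @leq_block_start k.+2 (block t).+1; have := @leq_block_start (block t).+2 k.+1.
have := block_start_lt k.+1; have := block_start_lt (block t).+1.
by case: eqP => //; lia.
Qed.

Lemma digits_coef_le t e : `|(digits t)`_e| <= (2 * d)%:Z.
Proof.
rewrite /digits coefD coefC; have := offset_le t.
case: ifPn => tl; rewrite ?coefB !coefXn; case: (e =P 0%N) => [->|]; move: d_gt0; first by lia.
- by case: eqP; lia.
- by rewrite (_ : (0 == _) = false); [lia|apply/negbTE; have := block_start_lt (block t); lia].
by case: eqP; case: eqP; lia.
Qed.

(** Modulo [b] only the constant coefficient remains, and it is too small to be
    a nonzero multiple of [b]; then divide by [b]. *)
Lemma poly_int_digits_eq0 (Q : {poly int}) (b : nat) :
  (forall i, `|Q`_i| < b%:Z) -> Q.[b%:Z] = 0 -> Q = 0.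
Proof.
elim/poly_ind: Q => // Q c IH Qb; rewrite !hornerE => Q0.
have cb : `|c| < b%:Z by have := Qb 0%N; rewrite coefD coefMX coefC add0r.
have Qz : Q.[b%:Z] = 0.
  apply/eqP; rewrite -absz_eq0 -leqn0 -ltnS ltnNge; apply/negP => Q1.
  have : (b <= absz (Q.[b%:Z] * b%:Z)%R)%N by rewrite abszM /= leq_pmull.
  have -> : Q.[b%:Z] * b%:Z = - c by apply/eqP; rewrite -addr_eq0 Q0.
  by move: cb; lia.
have c0 : c = 0 by move: Q0; rewrite Qz mul0r add0r.
rewrite IH // ?c0 ?mul0r ?addr0 // => i.
by have := Qb i.+1; rewrite coefD coefMX coefC addr0.
Qed.

Lemma digits_add_eq i j i' j' : (elem i + elem j = elem i' + elem j')%N ->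
  digits i + digits j = digits i' + digits j'.
Proof.
move=> e; apply/eqP; rewrite -subr_eq0; apply/eqP.
apply: (@poly_int_digits_eq0 _ base) => [k|]; last first.
  rewrite hornerD hornerN (hornerD (digits i)) (hornerD (digits i')).
  by rewrite -!elem_horner -!PoszD e subrr.
rewrite coefB (coefD (digits i)) (coefD (digits i')) /base.
have := digits_coef_le i k; have := digits_coef_le j k.
have := digits_coef_le i' k; have := digits_coef_le j' k.
move: (digits i)`_k (digits j)`_k (digits i')`_k (digits j')`_k => x y x' y'.
lia.
Qed.

(** If the digits of two elements cancel at the exponents of lower halves, the
    elements are mirror images of each other, and the digit at the center tells
    their block; otherwise these digits determine both elements. *)
Lemma elem_sum_eq i j i' j' : (elem i + elem j = elem i' + elem j')%N ->
  [\/ i = i' /\ j = j', i = j' /\ j = i' |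
      [/\ j = mirror i, j' = mirror i' & block i = block i']].
Proof.
move=> /digits_add_eq e.
have eL l : low l ->
    ((-1) ^+ (~~ low i) * (half i == l)%:Z + (-1) ^+ (~~ low j) * (half j == l)%:Z =
     (-1) ^+ (~~ low i') * (half i' == l)%:Z +
     (-1) ^+ (~~ low j') * (half j' == l)%:Z)%R.
  by move=> ll; rewrite -!digits_coef_low // -!coefD e.
have eS k : (~~ low i && (block i == k))%:Z + (~~ low j && (block j == k))%:Z =
   (~~ low i' && (block i' == k))%:Z + (~~ low j' && (block j' == k))%:Z.
  by rewrite -!natz -!digits_coef_start -!coefD e.
have : [|| [&& half i == half i', low i == low i', half j == half j' & low j == low j'],
   [&& half i == half j', low i == low j', half j == half i' & low j == low i'] |
   [&& half i == half j, low i != low j, half i' == half j' & low i' != low j']].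
  apply: signed_pair_matching => l; rewrite !inE.
  by case/or4P => /eqP->; apply: eL; exact: low_half.
case/or3P => /and4P[/eqP h1 /eqP l1 /eqP h2 /eqP l2].
- by constructor 1; split; apply: half_low_inj.
- by constructor 2; split; apply: half_low_inj.
have ji := half_mirrorP h1 l1; have ji' := half_mirrorP h2 l2.
constructor 3; split => //; have := eS (block i).
rewrite ji ji' !low_mirror !block_mirror eqxx.
by case: eqVneq => [->//|_]; rewrite !andbT !andbF; case: (low i).
Qed.

Lemma base_gt0 : (0 < base)%N.
Proof. by []. Qed.

Lemma base_expS e : (9 * base ^ e <= base ^ e.+1)%N.
Proof. by rewrite expnS leq_mul2r /base; apply/orP; right; move: d_gt0; lia. Qed.

Lemma base_exp_ge e : (base <= base ^ e.+1)%N.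
Proof. by rewrite expnS leq_pmulr // expn_gt0. Qed.

Lemma elem_lt t : (elem t < elem t.+1)%N.
Proof.
have ot := offset_le t; have oS := offset_le t.+1; have d0 := d_gt0.
have bt := block_bounds t.
have mS : ~~ low t.+1 -> ((mirror t.+1).+1 < block_start (block t.+1).+1)%N.
  exact: mirror_exp_lt.
(* The index [t.+1] either starts a new block, or stays in the same block with
   [t] and [t.+1] in the same half or on both sides of the middle. *)
rewrite /elem.
have [tk|/eqP tk] := eqVneq t.+1 (block_start (block t).+1).
  have bS : block t.+1 = (block t).+1 by rewrite /= tk eqxx.
  have lS : low t.+1 by rewrite lowP bS -tk -[ltnLHS]addn0 ltn_add2l.
  have lt : ~~ low t.
    by rewrite lowP -leqNgt; move: tk; rewrite block_startS; have := n_gt0 (block t); lia.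
  rewrite lS (negbTE lt) -tk.
  by have := base_expS t.+1; have := base_exp_ge t; rewrite /base; lia.
have bS : block t.+1 = block t by rewrite /=; case: eqP.
have [lS|lS] := boolP (low t.+1).
  have lt : low t by move: lS; rewrite !lowP bS; lia.
  rewrite lt; by have := base_expS t.+1; have := base_exp_ge t; rewrite /base; lia.
have := mS lS; rewrite bS => mSlt.
have mE : mirror t = (mirror t.+1).+1 by rewrite /mirror bS; move: bt tk; lia.
have hS := base_expS (mirror t.+1).+1; have hg := base_exp_ge (mirror t.+1).
have hp := @leq_pexp2l base (mirror t.+1).+2 _ base_gt0 mSlt.
have [lt|lt] := boolP (low t); last by rewrite mE; move: hg; rewrite {1}/base; lia.
have : (t <= mirror t.+1)%N by rewrite -ltnS -mE.
have : (mirror t.+1 <= t)%N by move: lS; rewrite -low_mirror /low mirrorK; lia.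
move=> h1 h2; have tm : mirror t.+1 = t by apply/eqP; rewrite eqn_leq h1.
by move: hg hS hp; rewrite tm {1}/base; lia.
Qed.

Definition mirror_set : set nat := range elem.

Lemma elem_inj : injective elem.
Proof.
apply: incn_inj; apply: leq_mono; apply: homo_ltn => [|i]; first exact: ltn_trans.
exact: elem_lt.
Qed.

Lemma mirror_set_infinite : infinite_set mirror_set.
Proof. exact: infinite_range_nat elem_inj. Qed.

Lemma elt_mirror_set t : elt mirror_set t = elem t.
Proof. exact: elt_range elem_lt. Qed.

Lemma depth_mirror t : depth (mirror t) = depth t.
Proof. by rewrite /depth half_mirror block_mirror. Qed.

Lemma elem_mirror t :
  (elem t + elem (mirror t) = center (block t) + shift (block t) (depth t))%N.
Proof.
wlog tl : t / low t => [hw|].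
  have [/hw//|tl] := boolP (low t).
  rewrite addnC -{2}(mirrorK t) hw ?low_mirror //.
  by rewrite block_mirror depth_mirror.
have mN : ~~ low (mirror t) by rewrite low_mirror tl.
rewrite /elem /offset tl (negbTE mN) depth_mirror block_mirror mirrorK /center.
have := mirror_exp_lt mN; rewrite mirrorK block_mirror => h.
by have := @leq_pexp2l base _ _ base_gt0 (ltnW h); lia.
Qed.

(** Two representations of the same integer must come from mirror pairs of one
    block, by [elem_sum_eq]; all the representations then do, and they are
    counted by the pairs with a given shift. *)
Lemma rep_mirror_set_le N : (rep mirror_set N <= 1)%N \/
  exists k i, [/\ (i < n k)%N, N = (center k + shift k i)%N &
    (rep mirror_set N <= #|[pred j : 'I_(n k) | shift k j == shift k i]|)%N].
Proof.
rewrite /rep; set P := [pred p | _].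
have PE p : (p \in P) = (p.1 <= p.2)%N && (elem p.1 + elem p.2 == N)%N.
  by rewrite inE !elt_mirror_set.
have [|/card_gt1P[[a b] [[a' b'] [+ + neq]]]] := leqP #|P| 1; first by left.
rewrite !PE /= => /andP[ab /eqP abN] /andP[ab' /eqP abN']; right.
have bE : (b : nat) = mirror a.
  have e : (elem a + elem b = elem a' + elem b')%N by rewrite abN abN'.
  case: (elem_sum_eq e) => [[aa bb]|[aa bb]|[] //]; case/eqP: neq.
    by congr pair; apply/val_inj.
  by congr pair; apply/val_inj => /=; lia.
have all_mirror p : p \in P -> (p.2 : nat) = mirror p.1 /\ block p.1 = block a.
  rewrite PE => /andP[p12 /eqP pN].
  have e : (elem a + elem b = elem p.1 + elem p.2)%N by rewrite abN pN.
  case: (elem_sum_eq e) => [[<- <-]//|[e1 e2]|[_ -> ->]//].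
  have ab_eq : (a : nat) = b by apply/eqP; rewrite eqn_leq ab e1 e2.
  by rewrite -e1 -e2 -ab_eq -bE.
have NE : N = (center (block a) + shift (block a) (depth a))%N.
  by rewrite -elem_mirror -bE.
exists (block a), (depth a); split; [exact: depth_lt|exact: NE|].
have P_low p : p \in P -> half p.1 = p.1.
  move=> pP; have [p2 _] := all_mirror p pP; rewrite /half ifT //.
  have : (p.1 <= p.2)%N by move: pP; rewrite PE => /andP[].
  rewrite p2 leq_eqVlt => /orP[/eqP e|//].
  by have := low_mirror p.1; rewrite -e; case: low.
pose f (p : 'I_N.+1 * 'I_N.+1) : 'I_(n (block a)) :=
  insubd (Ordinal (n_gt0 (block a))) (depth p.1).
have fE p : p \in P -> (f p : nat) = depth p.1.
  move=> /all_mirror[_ pa]; rewrite /f val_insubd ifT //.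
  by rewrite -pa; exact: depth_lt.
rewrite -(@card_in_imset _ _ f) => [|p q pP qP fpq].
  apply: subset_leq_card; apply/fintype.subsetP => j /imsetP[p pP ->].
  have [p2 pa] := all_mirror p pP; rewrite inE fE //.
  move: (pP); rewrite PE p2 elem_mirror pa => /andP[_ /eqP].
  by move=> e; rewrite -(eqn_add2l (center (block a))) -NE e.
have [p2 pa] := all_mirror p pP; have [q2 qa] := all_mirror q qP.
have pq : (p.1 : nat) = q.1.
  by rewrite -(P_low p pP) -(P_low q qP) !half_depth pa qa -fE // -fE // fpq.
have pq2 : (p.2 : nat) = q.2 by rewrite p2 q2 pq.
by case: p q pq pq2 {fpq pP qP p2 pa q2 qa} => [p1 p2] [q1 q2] /= e1 e2;
  congr pair; apply/val_inj.
Qed.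

Lemma rep_mirror_set_ge k v :
  (#|[pred j : 'I_(n k) | shift k j == v]| <= rep mirror_set (center k + v))%N.
Proof.
set N := (center k + v)%N.
have stN : (block_start k.+1 < N.+1)%N.
  by rewrite ltnS /N -[leqLHS]addn0 leq_add // ltnW // ltn_expl // /base; move: d_gt0; lia.
pose low_index (i : 'I_(n k)) := (block_start k + i)%N.
have bl (i : 'I_(n k)) : block (low_index i) = k by exact: block_low.
have lt1 i : (low_index i < N.+1)%N.
  by apply: ltn_trans stN; have := block_bounds (low_index i); rewrite bl; lia.
have lt2 i : (mirror (low_index i) < N.+1)%N.
  apply: ltn_trans stN; have := block_bounds (mirror (low_index i)).
  by rewrite block_mirror bl; lia.
pose g i : 'I_N.+1 * 'I_N.+1 := (Ordinal (lt1 i), Ordinal (lt2 i)).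
have g_inj : injective g.
  by move=> i j [] /addnI ij _; apply/val_inj.
rewrite /rep -(fintype.card_image g_inj); apply: subset_leq_card.
apply/fintype.subsetP => p /fintype.imageP[i]; rewrite !inE => /eqP iv ->.
rewrite !elt_mirror_set /= elem_mirror bl depth_low // iv eqxx andbT ltnW //.
exact: low_low.
Qed.

(** When in every block [k] at most [r k] pairs share a shift, and the smallest
    shift [tau k] is shared by exactly [r k] pairs, the counting function jumps
    to [r k] precisely at [jump k]. *)

Variables (r tau : nat -> nat).
Hypothesis r_gt0 : forall k, (0 < r k)%N.
Hypothesis r_le : forall k, (r k <= r k.+1)%N.
Hypothesis tau_le : forall k, (tau k <= 2 * d)%N.
Hypothesis shift_ge : forall k i, (i < n k)%N -> (tau k <= shift k i)%N.
Hypothesis shift_card : forall k v, (#|[pred j : 'I_(n k) | shift k j == v]| <= r k)%N.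
Hypothesis shift_card_tau : forall k, #|[pred j : 'I_(n k) | shift k j == tau k]| = r k.

Definition jump k := (center k + tau k)%N.

Lemma jump_gap k : (jump k + 4 * d < jump k.+1)%N.
Proof.
rewrite /jump /center; have := tau_le k; have := tau_le k.+1.
have := leq_pexp2l base_gt0 (block_start_lt k.+1).
have := base_expS (block_start k.+1); have := base_exp_ge (block_start k.+1).-1.
by rewrite prednK /base; [move: d_gt0; lia|have := block_start_lt k; lia].
Qed.

Lemma jump_lt k l : (k < l)%N -> (jump k < jump l)%N.
Proof.
have jS i : (jump i < jump i.+1)%N by have := jump_gap i; lia.
exact: (homo_ltn (r := fun x y => x < y)%N ltn_trans jS).
Qed.

Lemma s_upto_mirror_set_ge (R : realType) k (x : R) :
  (jump k)%:R <= x -> (r k <= s_upto mirror_set x)%N.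
Proof.
move=> kx; apply: leq_trans (rep_le_s_upto mirror_set kx).
by rewrite -shift_card_tau; exact: rep_mirror_set_ge.
Qed.

Lemma s_upto_mirror_set_le (R : realType) k (x : R) :
  x < (jump k.+1)%:R -> (s_upto mirror_set x <= r k)%N.
Proof.
move=> xk; apply: s_upto_le => N Nx.
have [|[k' [i [ik NE]]]] := rep_mirror_set_le N.
  by move/leq_trans; apply; exact: r_gt0.
move=> /leq_trans; apply; apply: leq_trans (shift_card _ _) _.
have Nk : (N < jump k.+1)%N by rewrite -(ltr_nat R) (le_lt_trans Nx).
have [kk|] := leqP k' k; first exact: (homo_leq (r := leq) leqnn leq_trans r_le).
have {}Nk : (center k' + shift k' i < jump k.+1)%N by rewrite -NE.
have := shift_ge ik => tk; rewrite leq_eqVlt => /orP[/eqP kE|kk].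
  by move: Nk; rewrite kE /jump; lia.
by have := jump_lt kk; rewrite {2}/jump; lia.
Qed.

End MirrorBlocks.

(** * Prescribed counting functions *)

Lemma card_divn_fiber (n r v : nat) : (0 < r)%N ->
  (#|[pred j : 'I_n | j %/ r == v]| <= r)%N.
Proof.
move=> r0; pose f (j : 'I_n) := Ordinal (ltn_pmod j r0).
rewrite -(@card_in_imset _ _ f) => [|i j].
  by apply: leq_trans (max_card _) _; rewrite card_ord.
rewrite !inE => /eqP iv /eqP jv [] ij; apply/val_inj => /=.
by rewrite (divn_eq i r) (divn_eq j r) iv jv ij.
Qed.

Lemma card_divn_fiber0 (n r : nat) : (0 < r)%N -> (r <= n)%N ->
  #|[pred j : 'I_n | j %/ r == 0]%N| = r.
Proof.
move=> r0 rn; rewrite -[RHS]card_ord.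
have w_inj : injective (widen_ord rn) by move=> i j [] ij; apply/val_inj.
rewrite -(fintype.card_image w_inj); apply: eq_card => j; rewrite !inE.
rewrite -leqn0 leqNgt divn_gt0 // -ltnNge; apply/idP/fintype.imageP => [jr|[i _ ->]]; last first.
  exact: (ltn_ord i).
by exists (Ordinal jr) => //; apply/val_inj.
Qed.

Section Shifts.

(** In a concentrated block all the pairs have the same sum; otherwise they are
    spread in successive groups of [r k] pairs.  The value [2 * d] in the first
    case is the middle of the range [0 .. 4 * d] of the second one, so that the
    halves of any two shifts differ by at most [d]. *)

Variables (d : nat) (n r : nat -> nat) (conc : nat -> bool).
Hypothesis r_gt0 : forall k, (0 < r k)%N.
Hypothesis n_r : forall k,
  if conc k then n k = r k else (r k <= n k <= (4 * d + 1) * r k)%N.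

Definition pair_shift k i := if conc k then (2 * d)%N else (i %/ r k)%N.

Definition pair_shift_min k := if conc k then (2 * d)%N else 0%N.

Lemma pair_shift_half k i : (i < n k)%N ->
  ((pair_shift k i)./2 <= 2 * d)%N /\
  (pair_shift k i - (pair_shift k i)./2 <= 2 * d)%N.
Proof.
move=> ik; suff : (pair_shift k i <= 4 * d)%N by move=> ?; split; lia.
rewrite /pair_shift; have := n_r k; case: ifP => _; first by lia.
by move=> /andP[_ nr]; rewrite -ltnS ltn_divLR // (leq_trans ik) // -addn1.
Qed.

Lemma pair_shift_ge k i : (i < n k)%N -> (pair_shift_min k <= pair_shift k i)%N.
Proof. by rewrite /pair_shift /pair_shift_min; case: ifP. Qed.

Lemma pair_shift_card k v : (#|[pred j : 'I_(n k) | pair_shift k j == v]| <= r k)%N.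
Proof.
rewrite /pair_shift; have := n_r k; case: ifP => [_ <-|_ _].
  by apply: leq_trans (max_card _) _; rewrite card_ord.
exact: card_divn_fiber.
Qed.

Lemma pair_shift_card_min k :
  #|[pred j : 'I_(n k) | pair_shift k j == pair_shift_min k]| = r k.
Proof.
rewrite /pair_shift /pair_shift_min; have := n_r k; case: ifP => [_ <-|_ /andP[rn _]].
  by rewrite -[RHS]card_ord; apply: eq_card => j; rewrite !inE eqxx.
exact: card_divn_fiber0.
Qed.

End Shifts.

(** In each block the set with the larger count is concentrated and the other
    one is spread.  The two sets have the same digits apart from the units, so
    they differ only by their offsets; the first pair of a spread block has
    shift [0] against [2 * d], which is why the distance [d] is attained. *)
Lemma exists_sets_prescribed_s (R : realType) (d : nat) (p q : nat -> nat) :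
  (0 < d)%N -> (forall k, 0 < p k)%N -> (forall k, 0 < q k)%N ->
  (forall k, p k <= p k.+1)%N -> (forall k, q k <= q k.+1)%N ->
  (forall k, p k <= (4 * d + 1) * q k)%N -> (forall k, q k <= (4 * d + 1) * p k)%N ->
  exists (A B : set nat) (jA jB : nat -> nat),
  [/\ infinite_set A, infinite_set B,
      (forall t, `|(elt A t)%:Z - (elt B t)%:Z| <= d)%N /\
        `|(elt A 0)%:Z - (elt B 0)%:Z|%N = d,
      (forall k, [/\ jA k + 4 * d < jA k.+1, jB k + 4 * d < jB k.+1,
                     jA k <= jB k + 2 * d & jB k <= jA k + 2 * d])%N &
      (forall k (x : R),
        [/\ (jA k)%:R <= x -> (p k <= s_upto A x)%N,
            x < (jA k.+1)%:R -> (s_upto A x <= p k)%N,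
            (jB k)%:R <= x -> (q k <= s_upto B x)%N &
            x < (jB k.+1)%:R -> (s_upto B x <= q k)%N])].
Proof.
move=> d0 p0 q0 pS qS pq qp.
pose n k := maxn (p k) (q k).
pose cA k := (q k < p k)%N; pose cB k := ~~ cA k.
have n0 k : (0 < n k)%N by rewrite leq_max p0.
have nA k : if cA k then n k = p k else (p k <= n k <= (4 * d + 1) * p k)%N.
  by rewrite /n /cA; have := qp k; case: ltnP; lia.
have nB k : if cB k then n k = q k else (q k <= n k <= (4 * d + 1) * q k)%N.
  by rewrite /n /cB /cA; have := pq k; case: ltnP => /=; lia.
have hA := pair_shift_half p0 nA; have hB := pair_shift_half q0 nB.
have tA k : (pair_shift_min d cA k <= 2 * d)%N by rewrite /pair_shift_min; case: ifP.
have tB k : (pair_shift_min d cB k <= 2 * d)%N by rewrite /pair_shift_min; case: ifP.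
exists (mirror_set n d (pair_shift d p cA)), (mirror_set n d (pair_shift d q cB)).
exists (jump n d (pair_shift_min d cA)), (jump n d (pair_shift_min d cB)).
split.
- exact: mirror_set_infinite.
- exact: mirror_set_infinite.
- have dE t : (`|(elt (mirror_set n d (pair_shift d p cA)) t)%:Z -
         (elt (mirror_set n d (pair_shift d q cB)) t)%:Z| =
       `|(offset n (pair_shift d p cA) t)%:Z - (offset n (pair_shift d q cB) t)%:Z|)%N.
    by rewrite !elt_mirror_set // /elem !PoszD opprD addrACA subrr add0r.
  split => [t|]; rewrite dE.
    have := offset_le n0 hA t; have := offset_le n0 hB t.
    rewrite /offset /pair_shift /cB mul2n.
    by case: (cA _) => /=; case: (low _ _); rewrite doubleK; move: (_ %/ _)%N; lia.
  (* Index [0] is the lower member of the first pair of the first block. *)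
  have b0 : block n 0 = 0%N by [].
  have l0 : low n 0 by rewrite (lowP n0) b0 /block_start big_ord0 n0.
  rewrite /offset /depth /half l0 b0 sub0n /pair_shift /cB.
  by case: (cA 0%N); rewrite /= div0n mul2n doubleK; lia.
- move=> k; split; try exact: jump_gap.
    by rewrite /jump; have := tA k; lia.
  by rewrite /jump; have := tB k; lia.
move=> k x; split.
- apply: s_upto_mirror_set_ge => //; exact: pair_shift_card_min.
- apply: s_upto_mirror_set_le => //; first exact: pair_shift_ge.
  exact: pair_shift_card.
- apply: s_upto_mirror_set_ge => //; exact: pair_shift_card_min.
- apply: s_upto_mirror_set_le => //; first exact: pair_shift_ge.
  exact: pair_shift_card.
Qed.

(** * Oscillating quotients *)

Lemma step_index (R : realType) (j : nat -> nat) (K : nat) (x : R) :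
  (forall k, j k < j k.+1)%N -> (j K)%:R <= x ->
  exists2 k, (K <= k)%N & (j k)%:R <= x < (j k.+1)%:R.
Proof.
move=> jS Kx; have x0 : 0 <= x := le_trans (ler0n _ _) Kx.
have j_ge k : (k <= j k)%N by elim: k => // k IH; have := jS k; lia.
have ex : exists k, (K <= k)%N && (Num.truncn x < j k.+1)%N.
  exists (maxn K (Num.truncn x)); rewrite leq_maxl /=.
  by apply: leq_trans (j_ge _); rewrite ltnS leq_maxr.
case: (ex_minnP ex) => k /andP[Kk xk] kmin; exists k => //.
rewrite -truncn_lt_nat // xk andbT -truncn_ge_nat //.
move: Kk; rewrite leq_eqVlt => /orP[/eqP<-|]; first by rewrite truncn_ge_nat.
case: k xk kmin => // k _ kmin Kk; rewrite leqNgt; apply/negP => xk.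
by have := kmin k; rewrite xk andbT -ltnS Kk => /(_ isT); rewrite ltnn.
Qed.

(** Between two jumps of [s_B] we have [s_B(x) = q k], while [x - 2 d] has not
    reached the next jump of [s_A] and [x + 2 d] has passed the current one.
    So [s_B(x) / s_A(x - 2 d)] is at least [q k / p k],
    [s_B(x) / s_A(x + 2 d)] is at most [q k / p k], and the gaps between the
    jumps leave room for both to be equalities. *)
Lemma s_ratio_limits (R : realType) (A B : set nat) (d : nat)
    (p q jA jB : nat -> nat) (alpha beta : R) :
  s_lim R A = +oo%E ->
  (forall k, [/\ jA k + 4 * d < jA k.+1, jB k + 4 * d < jB k.+1,
                 jA k <= jB k + 2 * d & jB k <= jA k + 2 * d])%N ->
  (forall k (x : R),
     [/\ (jA k)%:R <= x -> (p k <= s_upto A x)%N,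
         x < (jA k.+1)%:R -> (s_upto A x <= p k)%N,
         (jB k)%:R <= x -> (q k <= s_upto B x)%N &
         x < (jB k.+1)%:R -> (s_upto B x <= q k)%N]) ->
  (forall k, k < p k)%N ->
  (forall k, alpha * (p k)%:R - 1 <= (q k)%:R <= beta * (p k)%:R) ->
  (forall K, exists2 k, (K <= k)%N & (q k)%:R <= alpha * (p k)%:R) ->
  (forall K, exists2 k, (K <= k)%N & beta * (p k)%:R - 1 <= (q k)%:R) ->
  limf_einf (s_ratio A B (- (2 * d%:R))) +oo%R = alpha%:E /\
  limf_esup (s_ratio A B (2 * d%:R)) +oo%R = beta%:E.
Proof.
move=> Aoo jAB sAB pk qk qalpha qbeta.
have [M0 M0P] := s_lim_pinftyP 1 Aoo.
have jAS k : (jA k < jA k.+1)%N by have [] := jAB k; lia.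
have jBS k : (jB k < jB k.+1)%N by have [] := jAB k; lia.
have jA_ge k : (k <= jA k)%N by elim: k => // k IH; have := jAS k; lia.
have jB_ge k : (k <= jB k)%N by elim: k => // k IH; have := jBS k; lia.
have p0 k : 0 < (p k)%:R :> R by rewrite ltr0n (leq_trans _ (pk k)).
have dE : (2 * d%:R : R) = (2 * d)%:R by rewrite natrM.
rewrite dE; set c : R := (2 * d)%:R; have c0 : 0 <= c by exact: ler0n.
have jABr k : [/\ (jA k)%:R + c + c < (jA k.+1)%:R,
    (jB k)%:R + c + c < (jB k.+1)%:R, (jA k)%:R <= (jB k)%:R + c &
    (jB k)%:R <= (jA k)%:R + c :> R].
  by rewrite /c -!natrD !ltr_nat !ler_nat; have [] := jAB k; split; lia.
have near_quot (g e : R) : 0 < e -> exists K, forall k, (K <= k)%N ->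
    g * (p k)%:R - 1 <= (q k)%:R -> g - e <= (q k)%:R / (p k)%:R.
  move=> e0; exists (Num.truncn (e^-1)).+1 => k Kk gk.
  rewrite ler_pdivlMr // mulrBl (le_trans _ gk) // lerD2l lerN2.
  rewrite -ler_pdivrMl // mulr1; apply: ltW.
  apply: lt_le_trans (truncnS_gt _) _; rewrite ler_nat.
  exact: leq_trans Kk (ltnW (pk k)).
split; apply/eqP; rewrite eq_le; apply/andP; split.
- apply: limf_einf_pinfty_le => M.
  have [k Kk qka] := qalpha (Num.truncn M).+1.
  (* At this point [s_A(x - c)] is read exactly at the jump of [s_A]. *)
  exists ((jA k)%:R + c).
    apply: ltW; apply: lt_le_trans (truncnS_gt M) _.
    rewrite (@le_trans _ _ (jA k)%:R) ?lerDl // ler_nat.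
    exact: leq_trans Kk (jA_ge k).
  rewrite /s_ratio addrK lee_fin.
  have [/(_ (lexx _)) pA _ _ _] := sAB k (jA k)%:R.
  have [_ _ _ qB] := sAB k ((jA k)%:R + c).
  have {}qB : (s_upto B ((jA k)%:R + c) <= q k)%N.
    by apply: qB; have [h1 h2 h3 h4] := jABr k; lra.
  rewrite ler_pdivrMr; last by rewrite ltr0n (leq_trans _ pA) // (leq_trans _ (pk k)).
  apply: (@le_trans _ _ (q k)%:R); first by rewrite ler_nat.
  apply: le_trans (qka) _; rewrite ler_wpM2l ?ler_nat //.
  by rewrite -(pmulr_lge0 _ (p0 k)) (le_trans (ler0n _ (q k))).
- apply/lee_addgt0Pr => e e0; rewrite -leeBlDr //.
  have [K Kq] := near_quot alpha e e0.
  apply: (@limf_einf_pinfty_ge _ _ (Num.max (jB K)%:R (M0 + c))) => x.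
  rewrite ge_max => /andP[Kx M0x].
  have [k Kk /andP[kx xk]] := step_index jBS Kx.
  rewrite /s_ratio -EFinB lee_fin.
  have [/andP[ak _]] := (qk k); apply: le_trans (Kq k Kk ak) _.
  have [_ _ /(_ kx) qB _] := sAB k x; have [_ pA _ _] := sAB k (x - c).
  have {}pA : (s_upto A (x - c) <= p k)%N.
    by apply: pA; have [_ _ _ h] := jABr k.+1; lra.
  have spos : (0 < s_upto A (x - c))%N by apply: M0P; lra.
  rewrite ler_pdivrMr // mulrAC ler_pdivlMr ?ltr0n //.
  by rewrite -!natrM ler_nat leq_mul.
- apply: (@limf_esup_pinfty_le _ _ (jB 0%N)%:R) => x x0.
  have [k _ /andP[kx xk]] := step_index jBS x0.
  rewrite /s_ratio lee_fin.
  have [_ _ _ /(_ xk) qB] := sAB k x; have [pA _ _ _] := sAB k (x + c).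
  have {}pA : (p k <= s_upto A (x + c))%N.
    by apply: pA; have [_ _ h _] := jABr k; lra.
  rewrite ler_pdivrMr; last by rewrite ltr0n (leq_trans _ pA) // (leq_trans _ (pk k)).
  apply: (@le_trans _ _ (q k)%:R); first by rewrite ler_nat.
  have /andP[_ kb] := qk k; apply: le_trans (kb) _; rewrite ler_wpM2l ?ler_nat //.
  by rewrite -(pmulr_lge0 _ (p0 k)) (le_trans (ler0n _ (q k))).
apply/lee_addgt0Pr => e e0; rewrite -leeBlDr //.
have [K Kq] := near_quot beta e e0.
apply: limf_esup_pinfty_ge => M.
have [k] := qbeta (maxn K (Num.truncn M).+1); rewrite geq_max => /andP[Kk Mk] bk.
exists (jB k)%:R.
  apply: ltW; apply: lt_le_trans (truncnS_gt M) _.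
  by rewrite ler_nat (leq_trans Mk).
rewrite /s_ratio -EFinB lee_fin; apply: le_trans (Kq k Kk bk) _.
have [_ _ /(_ (lexx _)) qB _] := sAB k (jB k)%:R.
have [pA pA' _ _] := sAB k ((jB k)%:R + c).
have {}pA : (p k <= s_upto A ((jB k)%:R + c))%N.
  by apply: pA; have [_ _ h _] := jABr k; lra.
have {}pA' : (s_upto A ((jB k)%:R + c) <= p k)%N.
  by apply: pA'; have [h1 h2 h3 h4] := jABr k; lra.
have spos : (0 < s_upto A ((jB k)%:R + c))%N by rewrite (leq_trans _ pA) // (leq_trans _ (pk k)).
rewrite ler_pdivrMr // mulrAC ler_pdivlMr ?ltr0n //.
by rewrite -!natrM ler_nat leq_mul.
Qed.

Lemma s_lim_pinfty (R : realType) (A : set nat) (p j : nat -> nat) :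
  (forall k, k < p k)%N ->
  (forall k (x : R), (j k)%:R <= x -> (p k <= s_upto A x)%N) ->
  s_lim R A = +oo%E.
Proof.
move=> pk sA; rewrite s_limE; apply/eqyP => x x0.
pose k := (Num.truncn x).+1.
apply: (@le_trans _ _ (s_upto A ((j k)%:R : R))%:R%:E).
  rewrite lee_fin; apply: ltW; apply: lt_le_trans (truncnS_gt x) _.
  by rewrite ler_nat (leq_trans (ltnW (pk k))) // sA.
by apply: ereal_sup_ubound; exists (j k)%:R.
Qed.

Lemma d_limE_max (R : realType) (A B : set nat) (d : nat) : infinite_set A ->
  (forall t, `|(elt A t)%:Z - (elt B t)%:Z| <= d)%N ->
  (exists t, `|(elt A t)%:Z - (elt B t)%:Z|%N = d) ->
  d_lim R A B = d%:R%:E.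
Proof.
move=> Ainf AB [t td]; rewrite d_limE; apply/eqP; rewrite eq_le; apply/andP; split.
  apply: ge_ereal_sup => _ [x _ <-]; rewrite lee_fin ler_nat.
  by apply/bigmax_leqP => i _; exact: AB.
apply: (@le_trans _ _ (d_upto A B ((elt A t)%:R : R))%:R%:E).
  by rewrite lee_fin ler_nat -{1}td; exact: dist_le_d_upto.
by apply: ereal_sup_ubound; exists (elt A t)%:R.
Qed.

(** Multiplying [p] by [m ^ 2] at each step leaves room for [q] to be monotone
    although [q k / p k] may drop from [m] to [m^-1]; since [m] divides [p k],
    taking integer parts does not spoil [p k <= m * q k]. *)
Lemma exists_oscillating_steps (R : realType) (m : nat) (alpha beta : R) :
  (1 < m)%N -> m%:R^-1 <= alpha -> alpha <= beta -> beta <= m%:R ->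
  exists p q : nat -> nat,
  [/\ (forall k, k < p k)%N /\ (forall k, 0 < q k)%N,
      (forall k, p k <= p k.+1)%N /\ (forall k, q k <= q k.+1)%N,
      (forall k, p k <= m * q k)%N /\ (forall k, q k <= m * p k)%N,
      forall k, alpha * (p k)%:R - 1 <= (q k)%:R <= beta * (p k)%:R &
      (forall K, exists2 k, (K <= k)%N & (q k)%:R <= alpha * (p k)%:R) /\
      (forall K, exists2 k, (K <= k)%N & beta * (p k)%:R - 1 <= (q k)%:R)].
Proof.
move=> m1 ma ab bm.
have m0 : 0 < m%:R :> R by rewrite ltr0n; lia.
have a0 : 0 < alpha by apply: lt_le_trans ma; rewrite invr_gt0.
pose p k := (m ^ (2 * k).+2)%N.
pose g k := if odd k then beta else alpha.
pose q k := Num.truncn (g k * (p k)%:R).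
have pS k : p k = (m * m ^ (2 * k).+1)%N by rewrite /p expnS.
have ag k : alpha <= g k by rewrite /g; case: ifP.
have gb k : g k <= beta by rewrite /g; case: ifP.
have gp0 k : 0 <= g k * (p k)%:R by rewrite mulr_ge0 // (le_trans _ (ag k)) // ltW.
have q_itv k : (q k)%:R <= g k * (p k)%:R < (q k)%:R + 1.
  by rewrite natr1; exact: truncn_itv.
have q_ge k : (m ^ (2 * k).+1 <= q k)%N.
  rewrite truncn_ge_nat // pS natrM mulrA ler_peMl //.
  by rewrite -ler_pdivrMr // mul1r (le_trans ma).
have q_le k : (q k <= m * p k)%N.
  rewrite -(ler_nat R) natrM; have /andP[h _] := q_itv k; apply: le_trans h _.
  by rewrite ler_wpM2r // (le_trans (gb k)).
exists p, q; split.
- split=> k; last by apply: leq_trans (q_ge k); rewrite expn_gt0; lia.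
  by apply: (@leq_trans (2 * k).+2); [lia|exact: ltnW (ltn_expl _ m1)].
- split=> k; first by rewrite leq_pexp2l //; lia.
  by apply: leq_trans (q_le k) _; apply: leq_trans (q_ge _); rewrite -expnS leq_pexp2l //; lia.
- by split=> // k; rewrite pS leq_mul.
- move=> k; have /andP[h1 h2] := q_itv k; apply/andP; split.
    have : alpha * (p k)%:R <= g k * (p k)%:R by rewrite ler_wpM2r.
    by lra.
  by apply: le_trans h1 _; rewrite ler_wpM2r.
split=> K.
  exists (2 * K)%N; first by lia.
  have /andP[h1 _] := q_itv (2 * K)%N; apply: le_trans h1 _.
  by rewrite /g mul2n odd_double.
exists (2 * K).+1; first by lia.
have /andP[_ h2] := q_itv (2 * K).+1; move: h2.
by rewrite {1}/g /= mul2n odd_double /=; lra.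
Qed.

Theorem theorem4 (R : realType) :
  (forall A B : set nat, infinite_set A -> infinite_set B ->
     s_lim R A = +oo%E -> (d_lim R A B < +oo)%E ->
     let d : R := fine (d_lim R A B) in
     [/\ (((4 * d + 1)^-1)%:E <= limf_einf (s_ratio A B (- (2 * d))) +oo%R)%E,
         (limf_einf (s_ratio A B (- (2 * d))) +oo%R
            <= limf_esup (s_ratio A B (2 * d)) +oo%R)%E
       & (limf_esup (s_ratio A B (2 * d)) +oo%R <= (4 * d + 1)%:E)%E])
  /\
  (forall (d : nat) (alpha beta : R), (0 < d)%N -> 0 < alpha -> 0 < beta ->
     (4 * d%:R + 1)^-1 <= alpha -> alpha <= beta -> beta <= 4 * d%:R + 1 ->
     exists A B : set nat,
       [/\ infinite_set A, infinite_set B, s_lim R A = +oo%E,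
           d_lim R A B = (d%:R)%:E
         & limf_einf (s_ratio A B (- (2 * d%:R))) +oo%R = alpha%:E
           /\ limf_esup (s_ratio A B (2 * d%:R)) +oo%R = beta%:E]).
Proof.
split=> [A B Ainf Binf Aoo dfin d|d alpha beta d0 _ _ da ab bd].
  have [D dE AB] := d_lim_natP Ainf dfin.
  by rewrite /d dE /=; exact: s_ratio_bounds.
have mE : (4 * d%:R + 1 : R) = (4 * d + 1)%:R by rewrite natrD natrM.
rewrite mE in da bd.
have m1 : (1 < 4 * d + 1)%N by lia.
have [p [q [[pk q0] [pS qS] [pq qp] qab [qa qb]]]] :=
  exists_oscillating_steps m1 da ab bd.
have p0 k : (0 < p k)%N by apply: leq_trans (pk k).
have [A [B [jA [jB [Ainf Binf [AB AB0] jAB sAB]]]]] :=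
  exists_sets_prescribed_s R d0 p0 q0 pS qS pq qp.
have Aoo : s_lim R A = +oo%E.
  by apply: (s_lim_pinfty (p := p) (j := jA)) => // k x; have [] := sAB k x.
exists A, B; split => //; first by apply: d_limE_max => //; exists 0%N.
exact: (s_ratio_limits Aoo jAB sAB).
Qed.
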